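(* Let $P$ be an Eulerian poset. The right augmented Chow polynomial $F_P(x)$ of $P$ (with respect to the Eulerian kernel) equals the toric $h$-polynomial of the stellahedral transform $\operatorname{Stell}(P)$: $$F_P(x)=h_{\operatorname{Stell}(P)}(x).$$
   Context: Posets are finite, bounded (with minimum $\widehat 0$ and maximum $\widehat 1$) and graded with rank function $\rho$ (length of maximal chains from $\widehat 0$); $\rho_{st}=\rho(t)-\rho(s)$. $P$ is Eulerian if its Möbius function satisfies $\mu_{st}=(-1)^{\rho_{st}}$ for all $s\le t$. The stellahedral transform of an Eulerian poset is again Eulerian. Stellahedral transform: $$\operatorname{Stell}(P)=\{(c,y): c=\{\widehat 0=c_0<c_1<\dots<c_k\}\text{ a chain in }P \ (k\ge 0),\ y\in P,\ c_k\le y\}\sqcup\{\widehat 1_{\operatorname{Stell}}\},$$ where $\widehat 1_{\operatorname{Stell}}$ is a maximum element and $(c,y)\le(c',y')$ if and only if $c\subseteq c'$ and $y\ge y'$ in $P$. Incidence algebra: $\mathcal I(P)$ consists of functions $a$ assigning to each closed interval $[s,t]$ a polynomial $a_{st}(x)\in\mathbb Z[x]$, with product $(ab)_{st}=\sum_{s\le w\le t}a_{sw}b_{wt}$ and identity $\delta$. $\mathcal I_\rho(P)$ is the subalgebra of those $a$ with $\deg a_{st}\le\rho_{st}$, and $a^{\mathrm{rev}}_{st}(x)=x^{\rho_{st}}a_{st}(x^{-1})$. For $P$ Eulerian, the Eulerian kernel is $\varepsilon_{st}=(x-1)^{\rho_{st}}$. The right KLS function $f$ and left KLS function $g$ are the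 unique elements of $\mathcal I_\rho(P)$ with $f_{ss}=g_{ss}=1$, $\deg f_{st},\deg g_{st}<\tfrac12\rho_{st}$ for $s<t$, and $f^{\mathrm{rev}}=\varepsilon f$, $g^{\mathrm{rev}}=g\,\varepsilon$. Put $g_P=g_{\widehat 0\widehat 1}$. The toric $h$-polynomial of an Eulerian poset $P$ (of positive rank) is $$h_P(x)=\frac{g_P^{\mathrm{rev}}(x)-g_P(x)}{x-1},$$ where $g_P^{\mathrm{rev}}=g^{\mathrm{rev}}_{\widehat 0\widehat 1}$. The reduced Eulerian kernel is $\overline\varepsilon_{st}=(x-1)^{\rho_{st}-1}$ for $s<t$ and $\overline\varepsilon_{ss}=-1$. Set $\mathrm H=-(\overline\varepsilon)^{-1}$ and $F=\mathrm H\cdot f^{\mathrm{rev}}$. The right augmented Chow polynomial of $P$ is $F_P(x)=F_{\widehat 0\widehat 1}(x)$. *)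

(* Defs.v *)
From HB Require Import structures.
From mathcomp Require Import all_boot all_order all_algebra.
From mathcomp Require Import boolp.
From mathcomp Require classical_sets.

Set Implicit Arguments.
Unset Strict Implicit.
Unset Printing Implicit Defensive.

Import Order.TTheory GRing.Theory.
Local Open Scope order_scope.
Local Open Scope ring_scope.

Section Graded.
Context {d : Order.disp_t} {P : finTBPOrderType d}.
Implicit Types (s t w y : P) (C D : {set P}).

Definition chain C := [forall s in C, forall t in C, (s >=< t)%O].

Definition chain_below t C := chain C && [forall s in C, (s <= t)%O].

(* For a bounded poset this is equivalent to asking only that all maximal
   chains of the whole poset, i.e. the case t = \top, have the same length. *)
Definition graded : Prop :=
  forall t C D, maxset (chain_below t) C -> maxset (chain_below t) D ->
    #|C| = #|D|.

(* The length of a chain with m elements is m - 1.  When P is graded, every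
   maximal chain from \bot to t has length [rank t]. *)
Definition rank t : nat := (\max_(C : {set P} | chain_below t C) #|C|).-1.

Definition rho s t : nat := (rank t - rank s)%N.

End Graded.
Arguments graded {d} P.

Section Incidence.
Context (R : nzRingType) {d : Order.disp_t} (P : finTBPOrderType d).

Definition inc_interval := {p : P * P | (p.1 <= p.2)%O}.

(* An alias of {ffun inc_interval -> R}, so that the product is convolution and
   not the pointwise product. *)
Definition incidence := {ffun inc_interval -> R}.

HB.instance Definition _ := GRing.Zmodule.on incidence.

Definition mkinc (F : P -> P -> R) : incidence :=
  [ffun i : inc_interval => F (val i).1 (val i).2].

(* [inc_val a s t] is a_st; it is 0 when s <= t fails. *)
Definition inc_val (a : incidence) (s t : P) : R :=
  if insub (s, t) is Some i then (a : {ffun inc_interval -> R}) i else 0.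

Lemma inc_valE F s t : inc_val (mkinc F) s t = if (s <= t)%O then F s t else 0.
Proof. by rewrite /inc_val; case: insubP => [i /= -> si|/= /negbTE-> //]; rewrite ffunE /= si. Qed.

Lemma inc_val_out (a : incidence) s t : ~~ (s <= t)%O -> inc_val a s t = 0.
Proof. by move=> nst; rewrite /inc_val insubF //; exact: negbTE. Qed.

Lemma incP (a b : incidence) :
  (forall s t, (s <= t)%O -> inc_val a s t = inc_val b s t) -> a = b.
Proof.
move=> eqab; apply/ffunP => i; have := eqab _ _ (valP i).
by rewrite /inc_val -surjective_pairing valK.
Qed.

Lemma inc_valD (a b : incidence) s t : inc_val (a + b) s t = inc_val a s t + inc_val b s t.
Proof. by rewrite /inc_val; case: insubP => [i _ _|_]; rewrite ?ffunE ?addr0. Qed.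

Definition inc_one : incidence := mkinc (fun s t => (s == t)%:R).

Definition inc_mul (a b : incidence) : incidence :=
  mkinc (fun s t => \sum_(w | (s <= w <= t)%O) inc_val a s w * inc_val b w t).

Lemma inc_mulE a b s t : inc_val (inc_mul a b) s t = \sum_w inc_val a s w * inc_val b w t.
Proof.
rewrite inc_valE; case: ifPn => st.
  rewrite [RHS](bigID (fun w => (s <= w <= t)%O)) /= [X in _ + X]big1 ?addr0 //.
  by move=> w /nandP[] /inc_val_out->; rewrite ?mul0r ?mulr0.
rewrite big1 // => w _; have [sw|/inc_val_out->] := boolP (s <= w)%O; last exact: mul0r.
by rewrite [inc_val b w t]inc_val_out ?mulr0 //; apply: contra st; exact: le_trans.
Qed.

Lemma inc_oneE s t : inc_val inc_one s t = (s == t)%:R.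
Proof. by rewrite inc_valE; case: eqVneq => [->|_]; rewrite ?lexx ?if_same. Qed.

Lemma inc_mulA : associative inc_mul.
Proof.
move=> a b c; apply: incP => s t _; rewrite !inc_mulE.
under eq_bigr do rewrite inc_mulE mulr_sumr.
rewrite exchange_big /=; apply: eq_bigr => w _; rewrite inc_mulE mulr_suml.
by apply: eq_bigr => u _; rewrite mulrA.
Qed.

Lemma inc_mul1l : left_id inc_one inc_mul.
Proof.
move=> a; apply: incP => s t _; rewrite inc_mulE (bigD1 s) //= inc_oneE eqxx mul1r.
by rewrite big1 ?addr0 // => w ws; rewrite inc_oneE eq_sym (negbTE ws) mul0r.
Qed.

Lemma inc_mul1r : right_id inc_one inc_mul.
Proof.
move=> a; apply: incP => s t _; rewrite inc_mulE (bigD1 t) //= inc_oneE eqxx mulr1.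
by rewrite big1 ?addr0 // => w wt; rewrite inc_oneE (negbTE wt) mulr0.
Qed.

Lemma inc_mulDl : left_distributive inc_mul +%R.
Proof.
move=> a b c; apply: incP => s t _; rewrite inc_valD !inc_mulE -big_split /=.
by apply: eq_bigr => w _; rewrite inc_valD mulrDl.
Qed.

Lemma inc_mulDr : right_distributive inc_mul +%R.
Proof.
move=> a b c; apply: incP => s t _; rewrite inc_valD !inc_mulE -big_split /=.
by apply: eq_bigr => w _; rewrite inc_valD mulrDr.
Qed.

Lemma inc_one_neq0 : inc_one != 0.
Proof.
apply/eqP => /(congr1 (fun a : incidence => inc_val a \bot%O \bot%O)); rewrite inc_oneE eqxx.
by rewrite /inc_val; case: insubP => [i _ _|_] /eqP; rewrite ?ffunE oner_eq0.
Qed.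

HB.instance Definition _ := GRing.Zmodule_isNzRing.Build incidence
  inc_mulA inc_mul1l inc_mul1r inc_mulDl inc_mulDr inc_one_neq0.

Definition inc_inverse (a b : incidence) : Prop := b * a = 1 /\ a * b = 1.

Definition inc_unit : {pred incidence} := fun a => `[< exists b, inc_inverse a b >].

(* The two-sided inverse of a in the incidence algebra, and a itself if there
   is none, as the library requires. *)
Definition inc_inv (a : incidence) : incidence := classical_sets.xget a (inc_inverse a).

Lemma inc_invP a : a \in inc_unit -> inc_inverse a (inc_inv a).
Proof. by move=> /asboolP[b ab]; exact: (classical_sets.xgetPex a (ex_intro _ b ab)). Qed.

Lemma inc_mulVr : {in inc_unit, left_inverse 1 inc_inv *%R}.
Proof. by move=> a /inc_invP[]. Qed.

Lemma inc_divrr : {in inc_unit, right_inverse 1 inc_inv *%R}.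
Proof. by move=> a /inc_invP[]. Qed.

Lemma inc_unitP a b : b * a = 1 /\ a * b = 1 -> a \in inc_unit.
Proof. by move=> ab; apply/asboolP; exists b. Qed.

Lemma inc_inv_out : {in [predC inc_unit], inc_inv =1 id}.
Proof. by move=> a /asboolP nu; apply: classical_sets.xgetPN => b ab; apply: nu; exists b. Qed.

HB.instance Definition _ := GRing.NzRing_hasMulInverse.Build incidence
  inc_mulVr inc_divrr inc_unitP inc_inv_out.

End Incidence.

Section Eulerian.
Context {d : Order.disp_t} (P : finTBPOrderType d).

Definition zeta : incidence int P := mkinc (fun _ _ => 1).

Definition moebius : incidence int P := zeta^-1.

Definition eulerian : Prop :=
  graded P /\ forall s t : P, (s <= t)%O -> inc_val moebius s t = (-1) ^+ rho s t.

End Eulerian.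

Section KLS.
Context {d : Order.disp_t} {P : finTBPOrderType d}.
Implicit Types a f g : incidence {poly int} P.

(* [size p] is deg p + 1, and 0 for p = 0. *)
Definition in_Irho a : Prop :=
  forall s t : P, (s <= t)%O -> (size (inc_val a s t) <= (rho s t).+1)%N.

(* x^n p(x^-1), for p of degree at most n. *)
Definition poly_rev (n : nat) (p : {poly int}) : {poly int} :=
  \poly_(i < n.+1) p`_(n - i).

Definition inc_rev a : incidence {poly int} P :=
  mkinc (fun s t => poly_rev (rho s t) (inc_val a s t)).

(* With p = 0 the bound holds, as it should: [(size 0).-1 = 0], and
   rho s t is positive for s < t in a graded poset. *)
Definition KLS_degree a : Prop :=
  forall s t : P, (s < t)%O -> ((size (inc_val a s t)).-1.*2 < rho s t)%N.

Definition eulerian_kernel : incidence {poly int} P :=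
  mkinc (fun s t => ('X - 1) ^+ rho s t).

Definition is_right_KLS f : Prop :=
  [/\ in_Irho f, forall s, inc_val f s s = 1, KLS_degree f &
      inc_rev f = eulerian_kernel * f].

Definition is_left_KLS g : Prop :=
  [/\ in_Irho g, forall s, inc_val g s s = 1, KLS_degree g &
      inc_rev g = g * eulerian_kernel].

Definition reduced_eulerian_kernel : incidence {poly int} P :=
  mkinc (fun s t => if s == t then -1 else ('X - 1) ^+ (rho s t).-1).

End KLS.

Section Polynomials.
Context {d : Order.disp_t} (P : finTBPOrderType d).

(* The elements satisfying [is_right_KLS] and [is_left_KLS]; both exist and are
   unique when P is Eulerian, and are 0 by convention if there is none. *)
Definition right_KLS : incidence {poly int} P := classical_sets.xget 0 (@is_right_KLS d P).
Definition left_KLS : incidence {poly int} P := classical_sets.xget 0 (@is_left_KLS d P).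

(* Division by the monic polynomial 'X - 1; it is exact because g and g^rev
   have the same value at 1. *)
Definition toric_h : {poly int} :=
  (inc_val (inc_rev left_KLS) \bot%O \top%O - inc_val left_KLS \bot%O \top%O) %/ ('X - 1).

Definition chow_H : incidence {poly int} P := - (reduced_eulerian_kernel)^-1.

Definition right_aug_chow_fun : incidence {poly int} P :=
  chow_H * inc_rev right_KLS.

Definition right_aug_chow : {poly int} := inc_val right_aug_chow_fun \bot%O \top%O.

End Polynomials.

Section Stellahedral.
Context {d : Order.disp_t} (P : finTBPOrderType d).

(* The chain {\bot = c_0 < ... < c_k} is represented by its set of elements;
   c_k <= y says that all its elements are <= y. *)
Definition stell_pair (u : {set P} * P) : bool :=
  (\bot%O \in u.1) && chain_below u.2 u.1.

(* [None] is the added maximum. *)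
Definition Stell := option {u : {set P} * P | stell_pair u}.

HB.instance Definition _ := Finite.on Stell.

Definition stell_le (a b : Stell) : bool :=
  match a, b with
  | _, None => true
  | None, Some _ => false
  | Some u, Some v =>
      ((val u).1 \subset (val v).1) && ((val v).2 <= (val u).2)%O
  end.

Lemma stell_le_refl : reflexive stell_le.
Proof. by case=> [u|] //=; rewrite subxx lexx. Qed.

Lemma stell_le_anti : antisymmetric stell_le.
Proof.
case=> [[[c y] pu]|] [[[c' y'] pv]|] //= /andP[/andP[uv yuv] /andP[vu yvu]].
congr Some; apply: val_inj => /=; congr pair.
  by apply/eqP; rewrite eqEsubset uv vu.
by apply: le_anti; rewrite yvu yuv.
Qed.

Lemma stell_le_trans : transitive stell_le.
Proof.
case=> [v|] [u|] [w|] //= /andP[uv yuv] /andP[vw yvw].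
by rewrite (subset_trans uv vw) (le_trans yvw yuv).
Qed.

Fact stell_display : Order.disp_t -> Order.disp_t.
Proof. exact: id. Qed.

HB.instance Definition _ := Order.Le_isPOrder.Build (stell_display d) Stell
  stell_le_refl stell_le_anti stell_le_trans.

Lemma stell_bot_proof : stell_pair ([set \bot%O], \top%O).
Proof.
rewrite /stell_pair /chain_below inE eqxx /=; apply/andP; split.
  by apply/forall_inP => s /set1P->; apply/forall_inP => t /set1P->; exact: comparablexx.
by apply/forall_inP => s _; exact: lex1.
Qed.

Definition stell_bot : Stell := Some (Sub _ stell_bot_proof).

Lemma stell_le0x (a : Stell) : (stell_bot <= a)%O.
Proof.
case: a => [v|] //; have /andP[v0 _] := valP v.
by change (([set \bot%O] \subset (val v).1) && ((val v).2 <= \top)%O); rewrite sub1set v0 lex1.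
Qed.

Lemma stell_lex1 (a : Stell) : (a <= (None : Stell))%O.
Proof. by case: a. Qed.

HB.instance Definition _ :=
  Order.hasBottom.Build (stell_display d) Stell stell_le0x.
HB.instance Definition _ :=
  Order.hasTop.Build (stell_display d) Stell stell_lex1.

End Stellahedral.

(* Main.v *)
Require Import Defs.
From mathcomp Require Import all_boot all_order all_algebra.
From mathcomp Require Import zify.
From mathcomp Require classical_sets.

(** Write E for the Eulerian kernel, f for the right KLS function of P, N for the
    element with entries (X - 1)^(rho - 1) for s < t and 0 on the diagonal, and
    H = (1 - N)^-1, so that F = H f^rev. The left KLS function g of the transform
    can be written down, and h is then visible in it.

    An interval from (c, y) to (c', y') is the product of the Boolean lattice of
    sets between c and c' with the dual of [y', y]. As g is 1 on Boolean
    lattices, is multiplicative and exchanges left and right under duality, its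
    value there has to be f_{y' y}. It remains to find g from (c, y) to the top.
    There the relation g^rev = g E reads g^rev - g = (X - 1) h, where h is the
    sum over the other elements (c', y') of f_{y' y} times (X - 1) to the power
    rank y' + 1 - #|c'|. This power is the product of one entry of N for each
    step of c' and of (X - 1)^(rho m y') for the maximum m of c', so that the sum
    over chains builds a geometric series in N ([sum_chains_below],
    [chain_sum_above]). The result ([stell_hE]) is

      h = (product of H over the steps of c) * (H E f)_{m y}, m the maximum of c,

    and H E f = H f^rev = F. For the bottom element, c = {0} and y = 1, this is
    F_P, as desired.

    What has to be justified is that some g of degree less than half the rank
    has g^rev - g = (X - 1) h, that is, that h is palindromic. This follows from
    E^rev = E^-1, which is the Eulerian property. It gives H^rev = H E
    ([rev_chow_H]), whose entries are X H_st for s < t, and so H_st is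
    palindromic of degree rho - 1; also F^rev = H^rev f = H E f = F.

    The definitions select KLS functions by their characteristic properties.
    Hence existence of f on P is shown by induction on the rank
    ([right_KLS_upto]), and uniqueness of left KLS functions
    ([left_KLS_unique]) identifies the explicit g with the selected one. *)

Set Implicit Arguments.
Unset Strict Implicit.
Unset Printing Implicit Defensive.

Import Order.TTheory GRing.Theory.
Local Open Scope ring_scope.

(** * Chains and ranks *)

Section Rank.
Context {d : Order.disp_t} {P : finTBPOrderType d}.
Implicit Types (s t y m : P) (C D : {set P}).

Lemma chainP C : reflect {in C &, forall s t, (s >=< t)%O} (chain C).
Proof.
apply: (iffP forall_inP) => [cC s t sC tC|cC s sC].
  exact: (forall_inP (cC s sC)).
by apply/forall_inP => t; exact: cC.
Qed.

Lemma chain_belowP t C :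
  reflect ({in C &, forall s t, (s >=< t)%O} /\ {in C, forall s, s <= t}%O)
          (chain_below t C).
Proof. by apply: (iffP andP) => -[/chainP cC /forall_inP]. Qed.

Lemma chain_belowS t C D : C \subset D -> chain_below t D -> chain_below t C.
Proof.
move=> /subsetP sCD /chain_belowP[cD tD]; apply/chain_belowP; split.
  by move=> s s' /sCD sD /sCD; exact: cD.
by move=> s /sCD; exact: tD.
Qed.

Lemma chain_below_le s t C : (s <= t)%O -> chain_below s C -> chain_below t C.
Proof.
move=> st /chain_belowP[cC sC]; apply/chain_belowP; split=> // w /sC ws.
exact: le_trans ws st.
Qed.

Lemma chain_below_add t C : chain_below t C -> chain_below t (t |: C).
Proof.
move=> /chain_belowP[cC tC]; apply/chain_belowP; split.
  move=> a b /setU1P[->|aC] /setU1P[->|bC]; first exact: comparablexx.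
  - by rewrite /Order.comparable tC ?orbT.
  - by rewrite /Order.comparable tC.
  - exact: cC.
by move=> a /setU1P[->|/tC].
Qed.

Lemma chain_below_notin s t C : chain_below s C -> (s < t)%O -> t \notin C.
Proof.
move=> /chain_belowP[_ sC] st; apply/negP => /sC ts.
by have := lt_le_trans st ts; rewrite ltxx.
Qed.

Lemma chain_below_card t C : chain_below t C -> (#|C| <= (rank t).+1)%N.
Proof.
by move=> tC; rewrite (leq_trans _ (leqSpred _)) // (leq_bigmax_cond (F := fun C => #|C|)).
Qed.

Lemma rank_chain t : {C | chain_below t C & #|C| = (rank t).+1}.
Proof.
have t0 : chain_below t set0 by apply/chain_belowP; split=> s; rewrite inE.
have [|C tC eC] := eq_bigmax_cond (A := chain_below t) (fun C => #|C|).
  by apply/card_gt0P; exists set0.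
have /chain_below_add tC1 := t0.
exists C => //; rewrite /rank eC prednK // -eC.
apply: (@leq_trans #|t |: set0|); last exact: leq_bigmax_cond.
by apply/card_gt0P; exists t; rewrite !inE eqxx.
Qed.

Lemma rank_lt s t : (s < t)%O -> (rank s < rank t)%N.
Proof.
move=> st; have [C sC eC] := rank_chain s.
have tC := chain_below_notin sC st.
have := chain_below_card (chain_below_add (chain_below_le (ltW st) sC)).
by rewrite cardsU1 tC eC add1n ltnS.
Qed.

Lemma rank_le s t : (s <= t)%O -> (rank s <= rank t)%N.
Proof. by rewrite le_eqVlt => /predU1P[->//|/rank_lt/ltnW]. Qed.

Lemma rho_ss s : rho s s = 0.
Proof. by rewrite /rho subnn. Qed.

Lemma rho_gt0 s t : (s < t)%O -> (0 < rho s t)%N.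
Proof. by move/rank_lt; rewrite subn_gt0. Qed.

Lemma rhoD s w t : (s <= w)%O -> (w <= t)%O -> rho s t = (rho s w + rho w t)%N.
Proof. by rewrite /rho => /rank_le sw /rank_le wt; lia. Qed.

(** Computes ranks without listing maximal chains: a strictly increasing phi
    bounds the length of chains from above, and descending along the third
    hypothesis produces a chain of the expected length. *)
Lemma rank_unique (phi : P -> nat) : phi \bot%O = 0 ->
  {homo phi : s t / (s < t)%O >-> (s < t)%N} ->
  (forall t, t != \bot%O -> exists2 s, (s < t)%O & phi t = (phi s).+1) ->
  forall t, rank t = phi t.
Proof.
move=> phi0 phi_lt phi_pred t; apply/eqP; rewrite eqn_leq; apply/andP; split.
  have [C /chain_belowP[cC tC] eC] := rank_chain t.
  rewrite -ltnS -eC -[X in (_ <= X)%N]card_ord.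
  have phi_le s : (s <= t)%O -> (phi s < (phi t).+1)%N.
    by rewrite le_eqVlt => /predU1P[->//|/phi_lt/ltnW].
  rewrite -(card_in_imset (f := fun s => inord (phi s) : 'I_(phi t).+1)).
    exact: max_card.
  move=> s s' sC s'C /(congr1 val); rewrite /= !inordK ?phi_le ?tC // => eq_phi.
  by case: (comparable_ltgtP (cC s s' sC s'C)) => // /phi_lt; rewrite eq_phi ltnn.
elim/ltn_ind: {t}(phi t) {-2}t (erefl (phi t)) => n IHn t phit.
have [->|/phi_pred[s st phis]] := eqVneq t \bot%O; first by rewrite phi0.
by rewrite phis (leq_ltn_trans _ (rank_lt st)) // (IHn (phi s)) // -phit phis.
Qed.

Lemma rank_bot : rank (\bot%O : P) = 0.
Proof.
have [C /chain_belowP[_ C0] /eqP] := rank_chain \bot%O.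
have sC : C \subset [set \bot%O].
  by apply/subsetP => s /C0; rewrite lex0 inE.
by have := subset_leq_card sC; rewrite cards1 => C1 /eqP eC; lia.
Qed.

(** Adding a minimal t above y to a maximal chain below y yields a maximal chain
    below t, and in a graded poset its length must be the rank of t. *)
Lemma graded_upper_cover y : graded P -> y != \top%O ->
  exists2 t, (y < t)%O & rank t = (rank y).+1.
Proof.
move=> grP yt.
have ex : exists t, (y < t)%O by exists \top%O; rewrite lt_def eq_sym yt lex1.
have [t0 yt0] := ex.
have [t yt' tmin] : exists2 t, (y < t)%O & forall w, (y < w)%O -> (w <= t)%O -> w = t.
  have [t yt1 tmin] := arg_minnP (P := fun t => (y < t)%O) rank yt0.
  exists t => // w /tmin; rewrite le_eqVlt leqNgt => /negP wt /predU1P[//|/rank_lt].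
  by move/wt.
exists t => //.
have [C yC eC] := rank_chain y.
have CM : maxset (chain_below y) C.
  apply/maxsetP; split=> // D yD sCD; apply/eqP.
  by rewrite eq_sym eqEcard sCD eC chain_below_card.
have Cmax w : chain_below y (w |: C) -> w \in C.
  have /maxsetP[_ Cmax /Cmax <-] := CM; last exact: subsetUr.
  by rewrite !inE eqxx.
have yC' : y \in C by apply/Cmax/chain_below_add.
have tC : chain_below t (t |: C).
  exact: chain_below_add (chain_below_le (ltW yt') yC).
have tnC := chain_below_notin yC yt'.
have tCM : maxset (chain_below t) (t |: C).
  apply/maxsetP; split=> // D tD sCD; apply/eqP; rewrite eqEsubset sCD andbT.
  have /chain_belowP[cD tD'] := tD.
  have sCD' : C \subset D by apply: subset_trans sCD; exact: subsetUr.
  have yD : y \in D by exact: (subsetP sCD').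
  apply/subsetP => w wD; rewrite !inE.
  case: (comparable_leP (cD w y wD yD)) => [wy|yw]; last first.
    by rewrite (tmin w) ?eqxx ?tD'.
  apply/orP; right; apply/Cmax/chain_belowP; split; last first.
    by move=> a /setU1P[-> //|]; have /chain_belowP[_] := yC; exact.
  move=> a b /setU1P[->|/(subsetP sCD') aD] /setU1P[->|/(subsetP sCD') bD];
  exact: cD.
have [D tD eD] := rank_chain t.
have DM : maxset (chain_below t) D.
  apply/maxsetP; split=> // D' tD' sDD'; apply/eqP.
  by rewrite eq_sym eqEcard sDD' eD chain_below_card.
by have := grP _ _ _ tCM DM; rewrite cardsU1 tnC eC eD => -[].
Qed.

End Rank.

(** * Reversal of polynomials *)

Section PolyRev.
Implicit Types (p q : {poly int}) (m n : nat).

Lemma coef_size p i : (size p <= i)%N -> p`_i = 0.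
Proof. exact: nth_default. Qed.

Lemma coef_poly_rev n p i : (poly_rev n p)`_i = if (i <= n)%N then p`_(n - i) else 0.
Proof. by rewrite coef_poly ltnS. Qed.

Lemma size_poly_rev n p : (size (poly_rev n p) <= n.+1)%N.
Proof. exact: size_poly. Qed.

Lemma poly_revD n : {morph poly_rev n : p q / p + q}.
Proof.
by move=> p q; apply/polyP => i; rewrite coefD !coef_poly_rev coefD; case: ifP; rewrite ?addr0.
Qed.

Lemma poly_revN n : {morph poly_rev n : p / - p}.
Proof.
by move=> p; apply/polyP => i; rewrite coefN !coef_poly_rev coefN; case: ifP; rewrite ?oppr0.
Qed.

Lemma poly_rev0 n : poly_rev n 0 = 0.
Proof. by apply/polyP => i; rewrite coef_poly_rev !coef0 if_same. Qed.

Lemma poly_rev_sum n (I : Type) (r : seq I) (A : pred I) (F : I -> {poly int}) :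
  poly_rev n (\sum_(i <- r | A i) F i) = \sum_(i <- r | A i) poly_rev n (F i).
Proof. exact: (big_morph _ (@poly_revD n) (poly_rev0 n)). Qed.

Lemma poly_revK n p : (size p <= n.+1)%N -> poly_rev n (poly_rev n p) = p.
Proof.
move=> pn; apply/polyP => i; rewrite !coef_poly_rev leq_subr.
case: leqP => i_n; first by rewrite subKn.
by rewrite coef_size // (leq_trans pn).
Qed.

Lemma poly_revZXn n c i : (i <= n)%N -> poly_rev n (c *: 'X^i) = c *: 'X^(n - i).
Proof.
move=> i_n; apply/polyP => j; rewrite coef_poly_rev !coefZ !coefXn.
case: leqP => jn; first by congr (_ * (_ : bool)%:R); lia.
by rewrite (_ : j == _ = false) ?mulr0 //; lia.
Qed.

Lemma poly_rev1 n : poly_rev n 1 = 'X^n.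
Proof. by rewrite -[1](expr0 'X) -[_ ^+ 0]scale1r poly_revZXn // subn0 scale1r. Qed.

Lemma poly_sum n p : (size p <= n.+1)%N -> p = \sum_(i < n.+1) p`_i *: 'X^i.
Proof.
move=> pn; rewrite -poly_def; apply/polyP => i; rewrite coef_poly.
by case: ltnP => // ni; rewrite coef_size // (leq_trans pn).
Qed.

Lemma size_mulD m n p q : (size p <= m.+1)%N -> (size q <= n.+1)%N ->
  (size (p * q)%R <= (m + n).+1)%N.
Proof. by move=> pm qn; have := size_polyMleq p q; lia. Qed.

Lemma poly_revM m n p q : (size p <= m.+1)%N -> (size q <= n.+1)%N ->
  poly_rev (m + n) (p * q) = poly_rev m p * poly_rev n q.
Proof.
move=> pm qn; rewrite (poly_sum pm) (poly_sum qn) mulr_suml !poly_rev_sum mulr_suml.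
apply: eq_bigr => i _; rewrite !mulr_sumr poly_rev_sum; apply: eq_bigr => j _.
have [im jn] : (i <= m)%N /\ (j <= n)%N by split; rewrite -ltnS.
rewrite -!scalerAl -!scalerAr !scalerA -!exprD !poly_revZXn ?leq_add //.
rewrite -scalerAl -scalerAr scalerA -exprD.
by congr (_ *: 'X^_); lia.
Qed.

Lemma poly_rev01 : poly_rev 0 1 = 1.
Proof. by rewrite poly_rev1 expr0. Qed.

Lemma size_X1_exp n : (size (('X - 1) ^+ n : {poly int})%R <= n.+1)%N.
Proof. by rewrite -polyC1 size_exp_XsubC. Qed.

Lemma poly_rev_X1_exp n : poly_rev n (('X - 1) ^+ n) = (1 - 'X) ^+ n.
Proof.
elim: n => [|n IHn]; first by rewrite !expr0 poly_rev01.
rewrite !exprS -add1n poly_revM ?IHn ?size_X1_exp ?(size_X1_exp 1) //; congr (_ * _).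
apply/polyP => -[|[|i]];
  by rewrite coef_poly_rev ?coefB ?coefX ?coef1 ?subr0 ?sub0r.
Qed.

Definition lower_half n q : {poly int} := - \poly_(i < uphalf n) q`_i.

Lemma lower_half_degree n q : (0 < n)%N -> ((size (lower_half n q)).-1.*2 < n)%N.
Proof.
move=> n0; rewrite /lower_half size_polyN.
have := size_poly (uphalf n) (fun i => q`_i); rewrite uphalfE.
by move: (size _) => k; lia.
Qed.

Lemma size_lower_half n q : (size (lower_half n q) <= n.+1)%N.
Proof.
rewrite /lower_half size_polyN; apply: leq_trans (size_poly _ _) _; rewrite uphalfE; lia.
Qed.

(** An antipalindromic q has a unique splitting g^rev - g with g of degree less
    than n/2, and g is read off from the low coefficients of q. This is how the
    Kazhdan-Lusztig-Stanley recursion determines its next value. *)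
Lemma lower_halfP n q : (size q <= n.+1)%N -> poly_rev n q = - q ->
  poly_rev n (lower_half n q) - lower_half n q = q.
Proof.
move=> qn /polyP q_anti; apply/polyP => i; have := q_anti i.
rewrite coefN coefB !coef_poly_rev !coefN !coef_poly.
have [i_n|n_i] := leqP i n; last by rewrite coef_size ?(leq_trans qn) // if_same.
rewrite uphalfE; case: (ltnP i); case: (ltnP (n - i)); rewrite ?opprK ?oppr0 ?add0r ?addr0 //.
- by move=> *; lia.
- by move=> _ _ ->; rewrite opprK.
(* Only the middle coefficient i = n/2 is left; it is its own opposite. *)
move=> i_big1 i_big2; have -> : (n - i)%N = i by lia.
by move: (q`_i) => z; lia.
Qed.

Lemma poly_rev_small n p : ((size p).-1.*2 < n)%N -> poly_rev n p = p -> p = 0.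
Proof.
move=> pn /polyP p_pal; apply/polyP => i; rewrite coef0.
have [i_n|n_i] := ltnP i.*2 n; last by apply: coef_size; lia.
by rewrite -p_pal coef_poly_rev; case: ifP => // _; apply: coef_size; lia.
Qed.

Definition palindromic n p := (size p <= n.+1)%N /\ poly_rev n p = p.

Lemma palindromicM m n p q :
  palindromic m p -> palindromic n q -> palindromic (m + n) (p * q).
Proof.
by move=> [pm p_pal] [qn q_pal]; split; rewrite ?size_mulD // poly_revM // p_pal q_pal.
Qed.

(** The factor X - 1 is antipalindromic of degree 1. *)
Lemma antipalindromic_mulX1 n p : palindromic n p ->
  (size (('X - 1) * p)%R <= n.+2)%N /\ poly_rev n.+1 (('X - 1) * p) = - (('X - 1) * p).
Proof.
move=> [pn p_pal]; have X1 := size_X1_exp 1; rewrite expr1 in X1.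
split; first exact: (size_mulD X1).
rewrite -add1n poly_revM // p_pal -[X in poly_rev 1 X]expr1 poly_rev_X1_exp expr1.
by rewrite -mulNr opprB.
Qed.

End PolyRev.

(** * The incidence algebra and its reversal *)

Section IncidenceTheory.
Context {R : nzRingType} {d : Order.disp_t} {P : finTBPOrderType d}.
Implicit Types (a b c : incidence R P) (s t w : P).

Lemma inc_valN a s t : inc_val (- a) s t = - inc_val a s t.
Proof. by rewrite /inc_val; case: insubP => [i _ _|_]; rewrite ?ffunE ?oppr0. Qed.

Lemma inc_valB a b s t : inc_val (a - b) s t = inc_val a s t - inc_val b s t.
Proof. by rewrite inc_valD inc_valN. Qed.

Lemma inc_val0 s t : inc_val (0 : incidence R P) s t = 0.
Proof. by rewrite /inc_val; case: insubP => [i _ _|_]; rewrite ?ffunE. Qed.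

Lemma inc_val1 s t : inc_val (1 : incidence R P) s t = (s == t)%:R.
Proof. exact: inc_oneE. Qed.

Lemma inc_valM a b s t : inc_val (a * b) s t = \sum_w inc_val a s w * inc_val b w t.
Proof. exact: inc_mulE. Qed.

Lemma inc_valM_itv a b s t :
  inc_val (a * b) s t = \sum_(w | (s <= w <= t)%O) inc_val a s w * inc_val b w t.
Proof.
rewrite inc_valM [LHS](bigID (fun w => (s <= w <= t)%O)) /= [X in _ + X]big1 ?addr0 //.
by move=> w /nandP[] /inc_val_out->; rewrite ?mul0r ?mulr0.
Qed.

Lemma inc_val_exp_small a k s t : (forall s, inc_val a s s = 0) -> (rho s t < k)%N ->
  inc_val (a ^+ k) s t = 0.
Proof.
move=> a0; elim: k s => // k IHk s st; rewrite exprS inc_valM_itv big1 // => w.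
case/andP; rewrite le_eqVlt => /predU1P[<-|sw wt]; first by rewrite a0 mul0r.
rewrite IHk ?mulr0 //; have := rho_gt0 sw; have := rhoD (ltW sw) wt; lia.
Qed.

(** A strictly upper triangular a is nilpotent, since each factor consumes at
    least one unit of rank, so the geometric series terminates. *)
Lemma inc_unit_1B a : (forall s, inc_val a s s = 0) -> 1 - a \is a GRing.unit.
Proof.
move=> a0; pose n := (rank (\top%O : P)).+1.
have an0 : a ^+ n = 0.
  apply: incP => s t _; rewrite inc_val0 inc_val_exp_small // ltnS.
  by rewrite /rho (leq_trans (leq_subr _ _)) // rank_le // lex1.
have right_inv : (1 - a) * (\sum_(i < n) a ^+ i) = 1.
  by apply: oppr_inj; rewrite -mulNr opprB -subrX1 an0 sub0r.
apply/unitrP; exists (\sum_(i < n) a ^+ i); split=> //.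
rewrite -[RHS]right_inv; apply: commr_sym; apply: commr_sum => i _.
by apply/commrX/commr_sym/commrB; [exact: commr1 | exact: commr_refl].
Qed.

Lemma inc_unit_diag1 a : (forall s, inc_val a s s = 1) -> a \is a GRing.unit.
Proof.
move=> a1; rewrite -[a](subKr 1); apply: inc_unit_1B => s.
by rewrite inc_valB inc_val1 eqxx a1 subrr.
Qed.

Lemma inc_valM_ss a b s : inc_val (a * b) s s = inc_val a s s * inc_val b s s.
Proof.
rewrite inc_valM_itv (big_pred1 s) // => w.
by apply/idP/eqP => [/andP[sw ws]|->]; [apply/le_anti/andP | rewrite lexx].
Qed.

Lemma inc_valM_left a b s t : (s <= t)%O -> inc_val a s s = 1 ->
  inc_val (a * b) s t =
    inc_val b s t + \sum_(w | (s < w)%O && (w <= t)%O) inc_val a s w * inc_val b w t.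
Proof.
move=> st a1; rewrite inc_valM_itv (bigD1 s) ?lexx //= a1 mul1r; congr (_ + _).
by apply: eq_bigl => w; rewrite lt_def andbC andbA.
Qed.

Lemma inc_valM_right a b s t : (s <= t)%O -> inc_val b t t = 1 ->
  inc_val (a * b) s t =
    inc_val a s t + \sum_(w | (s <= w)%O && (w < t)%O) inc_val a s w * inc_val b w t.
Proof.
move=> st b1; rewrite inc_valM_itv (bigD1 t) ?lexx ?andbT //= b1 mulr1; congr (_ + _).
by apply: eq_bigl => w; rewrite lt_neqAle -andbA [(w <= t)%O && _]andbC.
Qed.

End IncidenceTheory.

Section RevTheory.
Context {d : Order.disp_t} {P : finTBPOrderType d}.
Implicit Types (a b f g : incidence {poly int} P) (s t w : P).

Lemma inc_val_rev a s t : inc_val (inc_rev a) s t = poly_rev (rho s t) (inc_val a s t).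
Proof.
rewrite inc_valE; case: ifPn => // st.
by rewrite inc_val_out // poly_rev0.
Qed.

Lemma in_IrhoM a b : in_Irho a -> in_Irho b -> in_Irho (a * b).
Proof.
move=> ia ib s t st; rewrite inc_valM_itv; apply: (leq_trans (size_sum _ _ _)).
apply/bigmax_leqP => w /andP[sw wt]; rewrite (rhoD sw wt).
by apply: size_mulD; [exact: ia | exact: ib].
Qed.

Lemma in_IrhoD a b : in_Irho a -> in_Irho b -> in_Irho (a + b).
Proof.
move=> ia ib s t st; rewrite inc_valD (leq_trans (size_polyD _ _)) //.
by rewrite geq_max ia ?ib.
Qed.

Lemma in_IrhoN a : in_Irho a -> in_Irho (- a).
Proof. by move=> ia s t st; rewrite inc_valN size_polyN; exact: ia. Qed.

Lemma in_Irho1 : in_Irho (1 : incidence {poly int} P).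
Proof. by move=> s t st; rewrite inc_val1; case: (s == t); rewrite ?size_poly1 ?size_poly0. Qed.

Lemma in_Irho_rev a : in_Irho (inc_rev a).
Proof. by move=> s t st; rewrite inc_val_rev size_poly_rev. Qed.

Lemma inc_revM a b : in_Irho a -> in_Irho b ->
  inc_rev (a * b) = inc_rev a * inc_rev b.
Proof.
move=> ia ib; apply: incP => s t st; rewrite inc_val_rev !inc_valM_itv poly_rev_sum.
apply: eq_bigr => w /andP[sw wt]; rewrite (rhoD sw wt) poly_revM ?ia ?ib //.
by rewrite !inc_val_rev.
Qed.

Lemma inc_revK a : in_Irho a -> inc_rev (inc_rev a) = a.
Proof. by move=> ia; apply: incP => s t st; rewrite !inc_val_rev poly_revK // ia. Qed.

Lemma inc_revD : {morph @inc_rev d P : a b / a + b}.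
Proof. by move=> a b; apply: incP => s t st; rewrite inc_valD !inc_val_rev inc_valD poly_revD. Qed.

Lemma inc_revN : {morph @inc_rev d P : a / - a}.
Proof. by move=> a; apply: incP => s t st; rewrite inc_valN !inc_val_rev inc_valN poly_revN. Qed.

Lemma inc_rev1 : inc_rev (1 : incidence {poly int} P) = 1.
Proof.
apply: incP => s t st; rewrite inc_val_rev !inc_val1; case: eqVneq => [->|_].
  by rewrite rho_ss poly_rev01.
by rewrite poly_rev0.
Qed.

Local Notation E := (@eulerian_kernel d P).

Lemma eulerian_kernelE s t : (s <= t)%O -> inc_val E s t = ('X - 1) ^+ rho s t.
Proof. by move=> st; rewrite inc_valE st. Qed.

Lemma eulerian_kernel_ss s : inc_val E s s = 1.
Proof. by rewrite eulerian_kernelE // rho_ss expr0. Qed.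

Lemma in_Irho_eulerian_kernel : in_Irho E.
Proof. by move=> s t st; rewrite eulerian_kernelE // size_X1_exp. Qed.

Lemma eulerian_alternating_sum s t : eulerian P -> (s <= t)%O ->
  \sum_(w | (s <= w <= t)%O) (-1) ^+ rho s w = (s == t)%:R :> int.
Proof.
move=> [_ muE] st; have zeta1 s' : inc_val (zeta P) s' s' = 1 by rewrite inc_valE lexx.
rewrite -inc_val1 -(mulVr (inc_unit_diag1 zeta1)) inc_valM_itv.
by apply: eq_bigr => w /andP[sw wt]; rewrite muE // inc_valE wt mulr1.
Qed.

(** Entry (s, t) is (X - 1)^rho times the alternating sum of signs over [s, t],
    which vanishes for s < t because the inverse of zeta has entries (-1)^rho. *)
Lemma eulerian_kernel_rev : eulerian P -> inc_rev E * E = 1.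
Proof.
move=> eulP; apply: incP => s t st; rewrite inc_val1.
transitivity (('X - 1 : {poly int}) ^+ rho s t * (\sum_(w | (s <= w <= t)%O) (-1) ^+ rho s w)%:~R).
  rewrite inc_valM_itv raddf_sum /= mulr_sumr; apply: eq_bigr => w /andP[sw wt].
  rewrite inc_val_rev !eulerian_kernelE // poly_rev_X1_exp (rhoD sw wt) exprD.
  rewrite (_ : 1 - 'X = -1 * ('X - 1)); last by rewrite mulN1r opprB.
  by rewrite exprMn rmorphXn rmorphN1 [RHS]mulrC mulrA.
rewrite eulerian_alternating_sum //; case: eqVneq => [->|_].
  by rewrite rho_ss expr0 mul1r.
by rewrite mulr0.
Qed.

Lemma eulerian_kernel_rev_inv : eulerian P -> E * inc_rev E = 1.
Proof.
move=> eulP; have := congr1 (@inc_rev d P) (eulerian_kernel_rev eulP).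
rewrite inc_revM ?inc_revK ?inc_rev1 //; first exact: in_Irho_eulerian_kernel.
  exact: in_Irho_rev.
exact: in_Irho_eulerian_kernel.
Qed.

End RevTheory.

(** * Existence and uniqueness of Kazhdan-Lusztig-Stanley functions *)

Section KLSTheory.
Context {d : Order.disp_t} {P : finTBPOrderType d}.
Implicit Types (f g : incidence {poly int} P) (s t w : P).

Local Notation E := (@eulerian_kernel d P).

Lemma KLS_degreeD f g : KLS_degree f -> KLS_degree g -> KLS_degree (f + g).
Proof.
move=> df dg s t st; rewrite inc_valD.
have := df s t st; have := dg s t st.
move: (inc_val f s t) (inc_val g s t) => p q qn pn.
have : (size (p + q)%R <= maxn (size p) (size q))%N by exact: size_polyD.
lia.
Qed.

Lemma KLS_degreeN f : KLS_degree f -> KLS_degree (- f).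
Proof. by move=> df s t st; rewrite inc_valN size_polyN; exact: df. Qed.

(** At each new rank n the defect D = E f - f^rev of the previous approximation
    is antipalindromic: E^rev D = - D^rev, and below rank n the defect is zero, so
    that only the diagonal entry of E^rev contributes. Splitting D as e^rev - e
    with e of small degree and replacing f by f + e removes the defect. *)
Lemma right_KLS_upto n : eulerian P -> exists f,
  [/\ in_Irho f, forall s, inc_val f s s = 1, KLS_degree f &
      forall s t, (s <= t)%O -> (rho s t < n)%N ->
        inc_val (inc_rev f) s t = inc_val (E * f) s t].
Proof.
move=> eulP; elim: n => [|n [f [If f1 df fn]]].
  exists 1; split=> //; first exact: in_Irho1.
    by move=> s; rewrite inc_val1 eqxx.
  by move=> s t st; rewrite inc_val1 lt_eqF // size_poly0 rho_gt0.
(* For n = 0 there is nothing to correct, and e would alter the diagonal. *)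
case: (posnP n) => [n0|n_gt0].
  exists f; split=> // s t; rewrite le_eqVlt => /predU1P[<- _|st]; last first.
    by have := rho_gt0 st; lia.
  by rewrite inc_val_rev rho_ss f1 poly_rev01 inc_valM_ss f1 eulerian_kernel_ss mulr1.
have IE := @in_Irho_eulerian_kernel d P.
pose D := E * f - inc_rev f.
have ID : in_Irho D.
  by apply: in_IrhoD; [exact: in_IrhoM | apply/in_IrhoN/in_Irho_rev].
have D0 s t : (s <= t)%O -> (rho s t < n)%N -> inc_val D s t = 0.
  by move=> st stn; rewrite inc_valB -fn // subrr.
have Drev : inc_rev E * D = - inc_rev D.
  rewrite /D inc_revD inc_revN inc_revM // inc_revK // mulrBr mulrA eulerian_kernel_rev //.
  by rewrite mul1r opprB.
have Danti s t : (s <= t)%O -> rho s t = n ->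
    poly_rev n (inc_val D s t) = - inc_val D s t.
  move=> st stn; rewrite -stn -inc_val_rev -[inc_rev D]opprK -Drev inc_valN; congr (- _).
  have E1 : inc_val (inc_rev E) s s = 1 by rewrite inc_val_rev rho_ss eulerian_kernel_ss poly_rev01.
  rewrite inc_valM_left // big1 ?addr0 // => w /andP[sw wt].
  by rewrite D0 ?mulr0 //; have := rho_gt0 sw; have := rhoD (ltW sw) wt; lia.
pose e : incidence {poly int} P :=
  mkinc (fun s t => if rho s t == n then lower_half n (inc_val D s t) else 0).
have eE s t : (s <= t)%O ->
    inc_val e s t = if rho s t == n then lower_half n (inc_val D s t) else 0.
  by move=> st; rewrite inc_valE st.
exists (f + e); split.
- apply: in_IrhoD => // s t st; rewrite eE //; case: eqP => [->|_]; last by rewrite size_poly0.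
  exact: size_lower_half.
- by move=> s; rewrite inc_valD f1 eE // rho_ss eq_sym gtn_eqF ?addr0.
- apply: KLS_degreeD => // s t st; rewrite eE ?ltW //.
  by case: eqP => [->|_]; rewrite ?lower_half_degree // size_poly0 rho_gt0.
move=> s t st; rewrite ltnS => stn; rewrite mulrDr inc_revD !inc_valD.
rewrite [inc_val (E * e) s t]inc_valM_left ?eulerian_kernel_ss // big1 ?addr0; last first.
  move=> w /andP[sw wt]; rewrite eE // ltn_eqF ?mulr0 //.
  by have := rho_gt0 sw; have := rhoD (ltW sw) wt; lia.
rewrite [inc_val (inc_rev e) s t]inc_val_rev eE //.
have [stn'|st_n] := eqVneq; last by rewrite poly_rev0 !addr0 fn // ltn_neqAle st_n.
have := ID s t st; rewrite stn' => /lower_halfP/(_ (Danti s t st stn'))/eqP.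
by rewrite subr_eq inc_valB => /eqP ->; rewrite addrA [_ + (_ - _)]addrC subrK.
Qed.

Lemma right_KLSP : eulerian P -> is_right_KLS (@right_KLS d P).
Proof.
move=> eulP; apply: classical_sets.xgetPex.
have [f [If f1 df fn]] := right_KLS_upto (rank (\top%O : P)).+1 eulP.
exists f; split=> //; apply: incP => s t st; apply: fn => //.
by rewrite ltnS (leq_trans (leq_subr _ _)) // rank_le // lex1.
Qed.

(** Once two solutions agree on shorter intervals, their difference on the next
    interval is palindromic of degree less than rho/2, hence zero. *)
Lemma left_KLS_unique f g : is_left_KLS f -> is_left_KLS g -> f = g.
Proof.
move=> [If f1 df fr] [Ig g1 dg gr]; apply/eqP; rewrite -subr_eq0; apply/eqP.
have dD : KLS_degree (f - g) by apply/KLS_degreeD/KLS_degreeN.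
have rD : inc_rev (f - g) = (f - g) * E by rewrite inc_revD inc_revN fr gr mulrBl.
apply: incP => s t; rewrite inc_val0.
have [n] := ubnP (rho s t); elim: n t => // n IHn t stn.
rewrite le_eqVlt => /predU1P[<-|st]; first by rewrite inc_valB f1 g1 subrr.
apply: (poly_rev_small (dD _ _ st)); rewrite -inc_val_rev rD.
rewrite inc_valM_right ?eulerian_kernel_ss ?ltW // big1 ?addr0 // => w /andP[sw wt].
by rewrite IHn ?mul0r //; have := rho_gt0 wt; have := rhoD sw (ltW wt); lia.
Qed.

Lemma left_KLS_eq g : is_left_KLS g -> left_KLS P = g.
Proof.
move=> gP; apply: left_KLS_unique => //.
by apply: (classical_sets.xgetPex 0); exists g.
Qed.

End KLSTheory.

(** * Palindromicity of the Chow function and of the augmented Chow function *)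

Section Chow.
Context {d : Order.disp_t} {P : finTBPOrderType d}.
Implicit Types (a : incidence {poly int} P) (s t w : P).

Local Notation E := (@eulerian_kernel d P).
Local Notation H := (chow_H P).

(** With N the strictly upper triangular part of the reduced kernel, that kernel
    is N - 1, so that H = (1 - N)^-1, and E = 1 + (X - 1) N. *)
Definition strict_kernel : incidence {poly int} P :=
  mkinc (fun s t => if s == t then 0 else ('X - 1) ^+ (rho s t).-1).

Local Notation N := strict_kernel.

Lemma strict_kernel_ss s : inc_val N s s = 0.
Proof. by rewrite inc_valE lexx eqxx. Qed.

Lemma strict_kernel_lt s t : (s < t)%O -> inc_val N s t = ('X - 1) ^+ (rho s t).-1.
Proof. by move=> st; rewrite inc_valE ltW // lt_eqF. Qed.

Lemma in_Irho_strict_kernel : in_Irho N.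
Proof.
move=> s t; rewrite le_eqVlt => /predU1P[<-|st].
  by rewrite strict_kernel_ss size_poly0.
by rewrite strict_kernel_lt // (leq_trans (size_X1_exp _)) // ltnS leq_pred.
Qed.

Lemma chow_HE : H = (1 - N)^-1.
Proof.
rewrite /chow_H (_ : reduced_eulerian_kernel = - (1 - N)); first by rewrite invrN opprK.
apply: incP => s t st; rewrite inc_valN inc_valB inc_val1 !inc_valE st.
by case: eqP; rewrite ?subr0 ?sub0r ?opprK.
Qed.

Lemma chow_H_mulr : H * (1 - N) = 1.
Proof. by rewrite chow_HE mulVr // inc_unit_1B // => s; exact: strict_kernel_ss. Qed.

Lemma chow_H_mull : (1 - N) * H = 1.
Proof. by rewrite chow_HE mulrV // inc_unit_1B // => s; exact: strict_kernel_ss. Qed.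

Lemma chow_HN : H * N = H - 1.
Proof. by rewrite -chow_H_mulr mulrBr mulr1 opprB addrC subrK. Qed.

Lemma chow_NH : N * H = H - 1.
Proof. by rewrite -chow_H_mull mulrBl mul1r opprB addrC subrK. Qed.

Lemma chow_H_ss s : inc_val H s s = 1.
Proof.
have := congr1 (fun a => inc_val a s s) chow_H_mulr.
by rewrite inc_valM_ss inc_valB strict_kernel_ss inc_val1 eqxx subr0 mulr1.
Qed.

Lemma in_Irho_chow_H : in_Irho H.
Proof.
move=> s t; have [n] := ubnP (rho s t); elim: n s => // n IHn s stn st.
rewrite -[chow_H _](subrK 1) -chow_NH inc_valD.
apply: leq_trans (size_polyD _ _) _; rewrite geq_max (in_Irho1 st) andbT.
rewrite inc_valM_itv (leq_trans (size_sum _ _ _)) //.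
apply/bigmax_leqP => w /andP[]; rewrite le_eqVlt => /predU1P[<-|sw wt].
  by rewrite strict_kernel_ss mul0r size_poly0.
rewrite (rhoD (ltW sw) wt) size_mulD ?in_Irho_strict_kernel ?ltW // IHn //.
by have := rho_gt0 sw; have := rhoD (ltW sw) wt; lia.
Qed.

(** This is E = 1 + (X - 1) N, multiplied by a on the left. *)
Lemma inc_val_mul_kernel a s t :
  inc_val (a * E) s t = inc_val a s t + ('X - 1) * inc_val (a * N) s t.
Proof.
rewrite -[in RHS](mulr1 a) !inc_valM mulr_sumr -big_split /=; apply: eq_bigr => w _.
rewrite mulr1 mulrCA -mulrDr; congr (_ * _).
rewrite inc_val1; have [wt|nwt] := boolP (w <= t)%O; last first.
  by rewrite !inc_val_out // mulr0 addr0; case: eqVneq nwt => // ->; rewrite lexx.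
rewrite eulerian_kernelE //; move: wt; rewrite le_eqVlt => /predU1P[<-|wt].
  by rewrite eqxx rho_ss strict_kernel_ss mulr0 addr0.
by rewrite lt_eqF // add0r strict_kernel_lt // -exprS prednK // rho_gt0.
Qed.

Lemma chow_HE_lt s t : (s < t)%O -> inc_val (H * E) s t = 'X * inc_val H s t.
Proof.
move=> st; rewrite inc_val_mul_kernel chow_HN inc_valB inc_val1 lt_eqF // subr0.
by rewrite mulrBl mul1r addrC subrK.
Qed.

(** After multiplication by X - 1 the products with N become products with E,
    and E^rev E = 1. *)
Lemma rev_strict_kernel : eulerian P -> inc_rev (1 - N) = inc_rev E * (1 - N).
Proof.
move=> eulP; apply: incP => s t st; have X1 : 'X - 1 != 0 :> {poly int}.
  by rewrite -polyC1 polyXsubC_eq0.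
apply: (mulfI X1); rewrite mulrBr mulr1 inc_valB mulrBr.
have -> : ('X - 1) * inc_val (inc_rev E * N) s t = (s == t)%:R - inc_val (inc_rev E) s t.
  have := inc_val_mul_kernel (inc_rev E) s t; rewrite eulerian_kernel_rev // inc_val1 => ->.
  by rewrite [RHS]addrC addKr.
rewrite !inc_val_rev inc_valB inc_val1 eulerian_kernelE //.
move: st; rewrite le_eqVlt => /predU1P[<-|st].
  by rewrite eqxx rho_ss strict_kernel_ss subr0 expr0 poly_rev01 !mulr1 subrr subr0.
rewrite lt_eqF // sub0r sub0r opprK poly_revN strict_kernel_lt // poly_rev_X1_exp.
have [k ->] : exists k, rho s t = k.+1 by exists (rho s t).-1; rewrite prednK // rho_gt0.
rewrite -[in LHS](mul1r (_ ^+ _)) -add1n poly_revM ?size_poly1 ?size_X1_exp //.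
rewrite poly_rev1 expr1 poly_rev_X1_exp add1n exprS -[X in _ = _ + X]mul1r -mulrDl subrK.
by rewrite mulrN -mulNr opprB mulrCA.
Qed.

(** H^rev is inverse to (1 - N)^rev = E^rev (1 - N), and so is H E. *)
Lemma rev_chow_H : eulerian P -> inc_rev H = H * E.
Proof.
move=> eulP; have I1N : in_Irho (1 - N).
  by apply: in_IrhoD; [exact: in_Irho1 | exact/in_IrhoN/in_Irho_strict_kernel].
have inv : inc_rev (1 - N) * inc_rev H = 1.
  by rewrite -inc_revM ?chow_H_mull ?inc_rev1 //; exact: in_Irho_chow_H.
rewrite -[RHS]mulr1 -inv rev_strict_kernel // !mulrA -[H * E * _]mulrA.
by rewrite eulerian_kernel_rev_inv // mulr1 chow_H_mulr mul1r.
Qed.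

(** For s < t the reversal of H_st in degree rho is (H E)_st = X H_st. *)
Lemma palindromic_chow_H s t : eulerian P -> (s < t)%O ->
  palindromic (rho s t).-1 (inc_val H s t).
Proof.
move=> eulP st; have rho0 := rho_gt0 st.
have rev_eq : poly_rev (rho s t) (inc_val H s t) = 'X * inc_val H s t.
  by rewrite -inc_val_rev rev_chow_H // chow_HE_lt.
have sz : (size (inc_val H s t) <= (rho s t).-1.+1)%N.
  rewrite prednK //; have := size_poly_rev (rho s t) (inc_val H s t); rewrite rev_eq.
  by have [->|H0] := eqVneq (inc_val H s t) 0; rewrite ?size_poly0 // mulrC size_mulX // ltnS.
split=> //; apply/polyP => i; rewrite coef_poly_rev; case: leqP => i_rho; last first.
  by rewrite coef_size // (leq_trans sz).
have := congr1 (fun p : {poly int} => p`_i.+1) rev_eq.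
rewrite /= coef_poly_rev coefXM /= (_ : (i < rho s t)%N); last lia.
by move=> <-; congr (_`_ _); lia.
Qed.

(** F^rev = H^rev f = H E f = H f^rev = F. *)
Lemma palindromic_right_aug_chow s t : eulerian P -> (s <= t)%O ->
  palindromic (rho s t) (inc_val (right_aug_chow_fun P) s t).
Proof.
move=> eulP st; have [If _ _ rf] := right_KLSP eulP.
have IH := in_Irho_chow_H; have IE := @in_Irho_eulerian_kernel d P.
split; first by apply: in_IrhoM => //; exact: in_Irho_rev.
rewrite -inc_val_rev /right_aug_chow_fun inc_revM // ?inc_revK ?rev_chow_H //.
  by rewrite rf mulrA.
exact: in_Irho_rev.
Qed.

End Chow.

(** * Sums over chains containing a given chain *)

Section ChainSums.
Context {d : Order.disp_t} {P : finTBPOrderType d}.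
Implicit Types (c C : {set P}) (s t m y : P).

Local Notation E := (@eulerian_kernel d P).
Local Notation N := (@strict_kernel d P).
Local Notation H := (chow_H P).

Lemma subSn_split_le (a b k : nat) :
  (k <= a.+1)%N -> (a <= b)%N -> (b.+1 - k = (a.+1 - k) + (b - a))%N.
Proof. lia. Qed.

Lemma subn_split_lt (a b k : nat) :
  (k <= a.+1)%N -> (a < b)%N -> (b - k = (a.+1 - k) + (b - a).-1)%N.
Proof. lia. Qed.

Definition chain_max C : P := odflt \bot%O [pick m in C | chain_below m C].

Lemma chain_max_eq m C : chain_below m C -> m \in C -> chain_max C = m.
Proof.
move=> mC m_C; rewrite /chain_max; case: pickP => [w /andP[w_C wC]|/(_ m)]; last first.
  by rewrite m_C mC.
have [/chain_belowP[_ mC'] /chain_belowP[_ wC']] := (mC, wC).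
by apply/le_anti; rewrite /= mC' ?wC'.
Qed.

Lemma chain_maxP y C : chain_below y C -> \bot%O \in C ->
  chain_below (chain_max C) C /\ chain_max C \in C.
Proof.
move=> yC C0; have [m mC m_max] := arg_maxnP (P := mem C) (@rank d P) C0.
suff mtop : chain_below m C by rewrite (chain_max_eq mtop mC).
have /chain_belowP[cC _] := yC; apply/chain_belowP; split=> // s sC.
case: (comparable_leP (cC s m sC mC)) => // /rank_lt ms.
by have := m_max s sC; rewrite /= leqNgt ms.
Qed.

(** When \bot is in c, the exponent is the sum of rho - 1 over the steps of the
    chain C, so that each step carries an entry of N. *)
Definition chain_sum c y : {poly int} :=
  \sum_(C | [&& chain_below y C, c \subset C & y \in C]) ('X - 1) ^+ ((rank y).+1 - #|C|).

(** A chain below y is cut at its maximum m, and the remaining factor is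
    (X - 1)^(rho m y). *)
Lemma sum_chains_below c y : \bot%O \in c ->
  \sum_(C | chain_below y C && (c \subset C)) ('X - 1) ^+ ((rank y).+1 - #|C|) =
    \sum_m chain_sum c m * inc_val E m y.
Proof.
move=> c0; rewrite (partition_big chain_max (fun m => m <= y)%O) /=; last first.
  move=> C /andP[yC /subsetP/(_ _ c0) C0].
  by have [_ mC] := chain_maxP yC C0; have /chain_belowP[_] := yC; exact.
rewrite [RHS](bigID (fun m => m <= y)%O) /= [X in _ = _ + X]big1 ?addr0; last first.
  by move=> m my; rewrite inc_val_out ?mulr0.
apply: eq_bigr => m my; rewrite mulr_suml; apply: eq_big => C.
  apply/idP/idP => [/andP[/andP[yC cC] /eqP<-]|/and3P[mC cC m_C]].
    have [mC m_C] := chain_maxP yC (subsetP cC _ c0).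
    by rewrite mC cC m_C.
  by rewrite (chain_below_le my mC) cC (chain_max_eq mC m_C) eqxx.
case/andP=> /andP[yC cC] /eqP mE; rewrite eulerian_kernelE // -exprD; congr (_ ^+ _).
have [mC _] := chain_maxP yC (subsetP cC _ c0); rewrite mE in mC.
exact: subSn_split_le (chain_below_card mC) (rank_le my).
Qed.

(** Removing y leaves a chain with a maximum m < y, and the last step from m to y
    has weight N_my. *)
Lemma chain_sum_rec c y : \bot%O \in c -> y != \bot%O ->
  chain_sum c y = \sum_m chain_sum (c :\ y) m * inc_val N m y.
Proof.
move=> c0 y0; have cy0 : \bot%O \in c :\ y by rewrite !inE eq_sym y0.
rewrite /chain_sum (reindex_onto (fun C => y |: C) (fun C => C :\ y)) /=; last first.
  by move=> C /and3P[_ _ yC]; rewrite setD1K.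
rewrite (partition_big chain_max (fun m => m < y)%O) /=; last first.
  move=> C /andP[/and3P[yC cC _] /eqP CE].
  have C0 : \bot%O \in C by have := subsetP cC _ c0; rewrite !inE eq_sym (negbTE y0).
  have yC' : chain_below y C by exact: chain_belowS (subsetUr _ _) yC.
  have [_ mC] := chain_maxP yC' C0; have /chain_belowP[_ /(_ _ mC)] := yC'.
  rewrite le_eqVlt => /predU1P[my|//].
  by move: mC; rewrite my -CE !inE eqxx.
rewrite [RHS](bigID (fun m => m < y)%O) /= [X in _ = _ + X]big1 ?addr0; last first.
  move=> m my; have [|/inc_val_out->] := boolP (m <= y)%O; last exact: mulr0.
  by rewrite le_eqVlt (negbTE my) orbF => /eqP->; rewrite strict_kernel_ss mulr0.
apply: eq_bigr => m my; rewrite mulr_suml; apply: eq_big => C.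
  rewrite setU11 andbT -subDset; apply/idP/idP => [|/and3P[mC cC m_C]].
    case/andP=> /andP[/andP[yC cC] _] /eqP<-.
    have [mC m_C] := chain_maxP (chain_belowS (subsetUr _ _) yC) (subsetP cC _ cy0).
    by rewrite mC cC m_C.
  rewrite chain_below_add ?(chain_below_le (ltW my)) // cC (chain_max_eq mC m_C) eqxx.
  by rewrite setU1K ?eqxx // (chain_below_notin mC).
case/andP=> /andP[/and3P[yC cC _] /eqP CE] /eqP mE.
have C0 : \bot%O \in C by have := subsetP cC _ c0; rewrite !inE eq_sym (negbTE y0).
have yC' : chain_below y C by exact: chain_belowS (subsetUr _ _) yC.
have [mC m_C] := chain_maxP yC' C0; rewrite mE in mC.
have ynC : y \notin C by rewrite -CE !inE eqxx.
rewrite strict_kernel_lt // -exprD cardsU1 ynC; congr (_ ^+ _).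
by rewrite add1n subSS; exact: subn_split_lt (chain_below_card mC) (rank_lt my).
Qed.

Lemma chain_sum_out c m y : m \in c -> ~~ (m <= y)%O -> chain_sum c y = 0.
Proof.
move=> mc my; rewrite /chain_sum big_pred0 // => C; apply/negbTE; apply: contra my.
by case/and3P => /chain_belowP[_ yC] /subsetP/(_ _ mc) /yC.
Qed.

Lemma chain_below_bot : chain_below \bot%O [set \bot%O : P].
Proof.
apply/chain_belowP; split=> [s t|s] /set1P-> // /set1P->.
exact: comparablexx.
Qed.

Lemma chain_sum_bot : chain_sum [set \bot%O] \bot%O = 1.
Proof.
rewrite /chain_sum (big_pred1 [set \bot%O]) => [|C].
  by rewrite cards1 rank_bot expr0.
apply/and3P/eqP => [[/chain_belowP[_ C0] cC _]|->].
  by apply/eqP; rewrite eqEsubset cC andbT; apply/subsetP => s /C0; rewrite lex0 inE.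
by split; rewrite ?set11 ?chain_below_bot.
Qed.

(** Above the maximum m of c the chains are unconstrained, and summing products
    of entries of N over all chains from m to y gives the geometric series H. *)
Lemma chain_sum_above c m y : \bot%O \in c -> m \in c -> chain_below m c ->
  chain_sum c y = chain_sum c m * inc_val H m y.
Proof.
move=> c0 mc /chain_belowP[cc cm].
have [n] := ubnP (rank y); elim: n y => // n IHn y yn.
have [|nmy] := boolP (m <= y)%O; last first.
  by rewrite (chain_sum_out mc) // inc_val_out ?mulr0.
rewrite le_eqVlt => /predU1P[<-|my]; first by rewrite chow_H_ss mulr1.
have ync : y \notin c by apply/negP => /cm ym; have := lt_le_trans my ym; rewrite ltxx.
rewrite chain_sum_rec ?(gt_eqF (le_lt_trans (le0x m) my)) //.
rewrite (_ : c :\ y = c); last first.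
  by apply/setP => s; rewrite !inE; case: eqP => // ->; rewrite (negbTE ync).
have -> : inc_val H m y = inc_val (H * N) m y.
  by rewrite chow_HN inc_valB inc_val1 lt_eqF // subr0.
rewrite inc_valM mulr_sumr; apply: eq_bigr => w _; rewrite mulrA.
have [|/inc_val_out->] := boolP (w <= y)%O; last by rewrite !mulr0.
rewrite le_eqVlt => /predU1P[->|/rank_lt wy]; first by rewrite strict_kernel_ss !mulr0.
by rewrite IHn //; lia.
Qed.

(** The sum is the product of the entries of H over the steps of c, obtained by
    peeling off the maximum of c, and these entries are palindromic. *)
Lemma palindromic_chain_sum c m : eulerian P ->
  \bot%O \in c -> m \in c -> chain_below m c ->
  palindromic ((rank m).+1 - #|c|) (chain_sum c m).
Proof.
move=> eulP; have [n] := ubnP #|c|; elim: n c m => // n IHn c m cn c0 mc cm.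
have [m0|m_neq0] := eqVneq m \bot%O.
  have -> : c = [set \bot%O].
    apply/eqP; rewrite eqEsubset sub1set c0 andbT; apply/subsetP => s.
    by have /chain_belowP[_] := cm => /[apply]; rewrite m0 lex0 inE.
  rewrite m0 cards1 rank_bot chain_sum_bot; split; first by rewrite size_poly1.
  exact: poly_rev01.
have c'0 : \bot%O \in c :\ m by rewrite !inE eq_sym m_neq0.
have [cm' m1c] := chain_maxP (chain_belowS (subD1set c m) cm) c'0.
move: (chain_max _) cm' m1c => m1 cm' m1c.
have m1m : (m1 < m)%O.
  move: m1c; rewrite !inE lt_neqAle => /andP[->] m1c.
  by have /chain_belowP[_] := cm; exact.
have cardc : #|c| = #|c :\ m|.+1 by rewrite (cardsD1 m) mc.
rewrite chain_sum_rec // (_ : \sum_w _ = chain_sum (c :\ m) m1 * inc_val H m1 m); last first.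
  have -> : inc_val H m1 m = inc_val (H * N) m1 m.
    by rewrite chow_HN inc_valB inc_val1 lt_eqF // subr0.
  rewrite inc_valM mulr_sumr; apply: eq_bigr => w _; rewrite mulrA.
  by rewrite (chain_sum_above _ c'0 m1c cm').
rewrite (_ : _ - _ = ((rank m1).+1 - #|c :\ m|) + (rho m1 m).-1)%N.
  by apply: palindromicM; [apply: IHn => //; lia | exact: palindromic_chow_H].
by have := chain_below_card cm'; have := rank_lt m1m; rewrite /rho; lia.
Qed.

End ChainSums.

(** * The rank function of the stellahedral transform *)

Section StellRank.
Context {d : Order.disp_t} {P : finTBPOrderType d}.
Implicit Types (c C : {set P}) (y : P) (u v : {u : {set P} * P | stell_pair u}).

Definition stell_mk (p : {set P} * P) (pP : stell_pair p) : {u : {set P} * P | stell_pair u} :=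
  exist _ p pP.
Definition stell_card u : nat := #|(val u).1|.
Definition stell_elt u : P := (val u).2.
Arguments stell_card : simpl never.
Arguments stell_elt : simpl never.

Lemma stell_some_le u v : ((Some u : Stell P) <= Some v)%O =
  ((val u).1 \subset (val v).1) && (stell_elt v <= stell_elt u)%O.
Proof. by []. Qed.

Lemma stell_some_le_card u v : ((Some u : Stell P) <= Some v)%O ->
  (stell_card u <= stell_card v)%N.
Proof. by case/andP => /subset_leq_card. Qed.

Lemma stell_some_le_elt u v : ((Some u : Stell P) <= Some v)%O ->
  (stell_elt v <= stell_elt u)%O.
Proof. by case/andP. Qed.

Lemma stell_bot_in u : \bot%O \in (val u).1.
Proof. by have /andP[] := valP u. Qed.

Lemma stell_chain u : chain_below (stell_elt u) (val u).1.
Proof. by have /andP[] := valP u. Qed.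

Lemma stell_card_gt0 u : (0 < stell_card u)%N.
Proof. by apply/card_gt0P; exists \bot%O; exact: stell_bot_in. Qed.

Lemma stell_card_le u : (stell_card u <= (rank (stell_elt u)).+1)%N.
Proof. exact: chain_below_card (stell_chain u). Qed.

Lemma rank_le_top y : (rank y <= rank (\top%O : P))%N.
Proof. exact/rank_le/lex1. Qed.

(** Enlarging the chain by one element and lowering y by one rank both go up one
    step in the transform. *)
Definition stell_rank (a : Stell P) : nat :=
  if a is Some u then ((stell_card u).-1 + (rank (\top%O : P) - rank (stell_elt u)))%N
  else (rank (\top%O : P)).+1.

Lemma stell_rank_lt : {homo stell_rank : a b / (a < b)%O >-> (a < b)%N}.
Proof.
case=> [u|] [v|] //=; last first.
  by move=> _; have := stell_card_le u; have := rank_le_top (stell_elt u); lia.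
rewrite lt_neqAle => /andP[uv le_uv].
have := stell_some_le_card le_uv; have := rank_le (stell_some_le_elt le_uv).
have := stell_card_gt0 u; have := rank_le_top (stell_elt u).
have [|rv_le] := ltnP (rank (stell_elt v)) (rank (stell_elt u)); first lia.
have [|cv_le] := ltnP (stell_card u) (stell_card v); first lia.
move=> _ _ _ _; case/negP: uv; apply/eqP; congr Some; apply: val_inj.
have /andP[cuv yvu] := le_uv; apply/eqP.
rewrite (surjective_pairing (val u)) (surjective_pairing (val v)) xpair_eqE eqEcard cuv cv_le /=.
by move: yvu; rewrite le_eqVlt eq_sym => /orP[//|/rank_lt]; rewrite ltnNge rv_le.
Qed.

(** One step below the top is a maximal chain of P together with 1; one step below
    (c, y) is an upper cover of y, or a smaller chain when y = 1. *)
Lemma rank_stell a : graded P -> rank a = stell_rank a.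
Proof.
move=> grP; move: a; apply: rank_unique; [|exact: stell_rank_lt|].
  rewrite -[LHS]/(#|[set \bot%O : P]|.-1 + (rank (\top%O : P) - rank (\top%O : P)))%N.
  by rewrite cards1 subnn.
case=> [u|] u0 /=; last first.
  have [C tC eC] := rank_chain (\top%O : P).
  have tC0 : chain_below \top%O (\bot%O |: C).
    apply/chain_belowP; split=> [s t|s _]; last exact: lex1.
    have /chain_belowP[cC _] := tC.
    move=> /setU1P[->|sC] /setU1P[->|t_C]; try exact: cC.
    - exact: comparablexx.
    - by rewrite /Order.comparable le0x.
    - by rewrite /Order.comparable le0x orbT.
  have pC : stell_pair (\bot%O |: C, \top%O) by rewrite /stell_pair /= setU11.
  pose v := stell_mk pC.
  exists (Some v) => //=; have := stell_card_le v; rewrite /stell_elt /= subnn addn0.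
  have : (#|C| <= stell_card v)%N := subset_leq_card (subsetUr _ _).
  by rewrite eC; lia.
case: u u0 => -[c y] cy u0; have /andP[/= c0 yc] := cy.
have [y1|y1] := eqVneq y \top%O; last first.
  have [y' yy' ry'] := graded_upper_cover grP y1.
  have cy' : stell_pair (c, y') by rewrite /stell_pair /= c0 (chain_below_le (ltW yy')).
  have cardE : stell_card (stell_mk cy) = stell_card (stell_mk cy') by [].
  exists (Some (stell_mk cy')) => /=.
    rewrite lt_neqAle stell_some_le /= subxx /=; apply/andP; split; last exact: ltW.
    by apply/eqP => -[yE]; move: yy'; rewrite yE ltxx.
  by rewrite -/(stell_mk cy) cardE /stell_elt /= ry'; have := rank_le_top y'; lia.
have [m mc m0] : exists2 m, m \in c & m != \bot%O.
  apply/exists_inP; apply: contraNT u0 => /exists_inPn c1; apply/eqP; congr Some.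
  apply: val_inj => /=; rewrite -y1; congr pair; apply/setP => s; rewrite !inE.
  by apply/idP/eqP => [/c1/negPn/eqP //|->].
have cm : stell_pair (c :\ m, y).
  by rewrite /stell_pair /= !inE eq_sym m0 c0 (chain_belowS (subD1set _ _) yc).
pose u := stell_mk cy.
pose v := stell_mk cm.
exists (Some v) => /=.
  rewrite lt_neqAle stell_some_le /= subD1set /=; apply/andP; split; last exact: lexx.
  by apply/eqP => -[/setP/(_ m)]; rewrite !inE eqxx mc.
have cardc : stell_card u = (stell_card v).+1 by rewrite /stell_card (cardsD1 m) mc.
by have := stell_card_gt0 v; rewrite -/(stell_mk cy) -/u cardc /= /stell_elt /=; lia.
Qed.

Lemma rho_stell u v : graded P -> ((Some u : Stell P) <= Some v)%O ->
  rho (Some u : Stell P) (Some v) =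
    (stell_card v - stell_card u + rho (stell_elt v) (stell_elt u))%N.
Proof.
move=> grP le_uv; rewrite /rho !rank_stell //=.
have := stell_some_le_card le_uv; have := rank_le (stell_some_le_elt le_uv).
by have := stell_card_gt0 u; have := rank_le_top (stell_elt u); lia.
Qed.

Lemma rho_stell_top u : graded P ->
  rho (Some u : Stell P) None = ((rank (stell_elt u)).+1 - stell_card u).+1.
Proof.
move=> grP; rewrite /rho !rank_stell //=.
by have := stell_card_gt0 u; have := stell_card_le u; have := rank_le_top (stell_elt u); lia.
Qed.

(** Makes sums over the transform into sums over pairs of independent variables. *)
Lemma sum_stell (Q : pred (Stell P)) (Q' : pred ({set P} * P))
    (V : nmodType) (F : Stell P -> V) (F' : {set P} * P -> V) : ~~ Q None ->
  (forall v, Q (Some v) = Q' (val v)) -> (forall v, Q (Some v) -> F (Some v) = F' (val v)) ->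
  \sum_(a | Q a) F a = \sum_(p | stell_pair p && Q' p) F' p.
Proof.
move=> Q0 QE FE; rewrite (reindex_omap Some id) => [|[a|] //]; last by rewrite (negbTE Q0).
transitivity (\sum_(v : {u | stell_pair u} | Q' (val v)) F' (val v)).
  by apply: eq_big => v; rewrite eqxx andbT; [exact: QE | exact: FE].
exact: esym (big_sub_cond _ _ _).
Qed.

End StellRank.

(** The relation g^rev = g E for the Boolean lattice, where g is 1. *)
Lemma sum_between_exp (T : finType) (A B : {set T}) : A \subset B ->
  \sum_(C : {set T} | (A \subset C) && (C \subset B)) ('X - 1 : {poly int}) ^+ (#|B| - #|C|)
    = 'X ^+ (#|B| - #|A|).
Proof.
move=> AB.
pose F i : {poly int} := (i \in B)%:R.
pose G i : {poly int} := if i \in A then 0 else if i \in B then 'X - 1 else 1.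
have := bigA_distr 1 (@GRing.add {poly int}) F G.
rewrite (_ : \prod_i _ = 'X ^+ (#|B| - #|A|)); last first.
  rewrite -cardsDS // -prodr_const [RHS]big_mkcond /=; apply: eq_bigr => i _.
  rewrite /F /G !inE; have [/(subsetP AB)->|_] /= := boolP (i \in A); first by rewrite addr0.
  by case: (i \in B); rewrite ?add0r // addrC subrK.
move=> ->; rewrite [RHS](bigID (fun C : {set T} => (A \subset C) && (C \subset B))) /=.
rewrite [X in _ = _ + X]big1 ?addr0.
  apply: eq_bigr => C /andP[AC CB]; rewrite -cardsDS // -prodr_const [LHS]big_mkcond /=.
  apply: eq_bigr => i _; rewrite /F /G !inE.
  have [/(subsetP CB)->//|iC] /= := boolP (i \in C).
  by rewrite (negbTE (contraNN (subsetP AC i) iC)).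
move=> C /nandP[|] /subsetPn[i iA iC]; rewrite (bigD1 i) //= ?iA ?(negbTE iC) /F /G.
  by rewrite iA mul0r.
by rewrite (negbTE iC) mul0r.
Qed.

(** * The left Kazhdan-Lusztig-Stanley function of the transform *)

Section StellKLS.
Context {d : Order.disp_t} {P : finTBPOrderType d} (eulP : eulerian P).
Implicit Types (c C : {set P}) (y : P) (u v : {u : {set P} * P | stell_pair u}).

Local Notation E := (@eulerian_kernel d P).
Local Notation f := (@right_KLS d P).
Local Notation F := (right_aug_chow_fun P).
Local Notation ES := (@eulerian_kernel _ (Stell P)).

(** The closed form of the polynomial with g^rev - g = (X - 1) h on the interval
    from (c, y) to the top: entries of H over the steps of c, times F from the
    maximum of c to y. At the bottom it is F of P. *)
Definition stell_h u : {poly int} :=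
  chain_sum (val u).1 (chain_max (val u).1) *
    inc_val F (chain_max (val u).1) (stell_elt u).

Lemma palindromic_stell_h u :
  palindromic ((rank (stell_elt u)).+1 - stell_card u) (stell_h u).
Proof.
have [mc m_c] := chain_maxP (stell_chain u) (stell_bot_in u).
have my : (chain_max (val u).1 <= stell_elt u)%O.
  by have /chain_belowP[_] := stell_chain u; exact.
rewrite (_ : _ - _ = (((rank (chain_max (val u).1)).+1 - stell_card u)
                     + rho (chain_max (val u).1) (stell_elt u)))%N.
  apply: palindromicM; first exact: palindromic_chain_sum (stell_bot_in u) m_c mc.
  exact: palindromic_right_aug_chow.
exact: subSn_split_le (chain_below_card mc) (rank_le my).
Qed.

(** The sum is that of g_aw (X - 1)^(rho w 1 - 1) over the elements w of the
    interval other than its top 1. Summing over the chains first gives a row of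
    H E, up to a factor, and H E f = H f^rev = F. *)
Lemma stell_hE u :
  stell_h u = \sum_(p | stell_pair p && (((val u).1 \subset p.1) && (p.2 <= stell_elt u)%O))
    inc_val f p.2 (stell_elt u) * ('X - 1) ^+ ((rank p.2).+1 - #|p.1|).
Proof.
have [_ _ _ frev] := right_KLSP eulP.
have [mc m_c] := chain_maxP (stell_chain u) (stell_bot_in u).
have c0 := stell_bot_in u; rewrite /stell_h.
move: (val u).1 (stell_elt u) (chain_max _) c0 mc m_c => c y m c0 mc m_c.
transitivity (\sum_z (\sum_(C | chain_below z C && (c \subset C))
   ('X - 1) ^+ ((rank z).+1 - #|C|)) * inc_val f z y).
  under eq_bigr => z _ do rewrite sum_chains_below // mulr_suml.
  rewrite exchange_big /right_aug_chow_fun inc_valM mulr_sumr /=; apply: eq_bigr => w _.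
  rewrite (chain_sum_above w c0 m_c mc) frev inc_valM mulrA mulr_sumr.
  by apply: eq_bigr => z _; rewrite mulrA.
rewrite (bigID (fun z => z <= y)%O) /= [X in _ + X]big1 ?addr0; last first.
  by move=> z zy; rewrite [X in _ * X]inc_val_out ?mulr0.
under eq_bigr => z _ do rewrite mulr_suml.
rewrite (exchange_big_dep predT) //= pair_big_dep /=; apply: eq_big => -[C z] /=.
  rewrite /stell_pair /=; have [cC|] := boolP (c \subset C); last by rewrite !andbF.
  by rewrite (subsetP cC _ c0) /= andbT andbC.
by move=> _; rewrite mulrC.
Qed.

(** Below the top element the intervals are products of a Boolean lattice with a
    dual interval of P, where g is 1 and f respectively. In the top column the
    degree bound and g^rev - g = (X - 1) h leave no choice. *)
Definition stell_left_KLS : incidence {poly int} (Stell P) :=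
  mkinc (fun a b : Stell P => match a, b with
    | Some u, Some v => inc_val f (stell_elt v) (stell_elt u)
    | Some u, None => lower_half (rho a b) (('X - 1) * stell_h u)
    | None, _ => 1
    end).

Local Notation g := stell_left_KLS.

Lemma stell_left_KLS_some u v : ((Some u : Stell P) <= Some v)%O ->
  inc_val g (Some u) (Some v) = inc_val f (stell_elt v) (stell_elt u).
Proof. by move=> uv; rewrite inc_valE uv. Qed.

Lemma stell_left_KLS_top u :
  inc_val g (Some u) None = lower_half (rho (Some u : Stell P) None) (('X - 1) * stell_h u).
Proof. by rewrite inc_valE. Qed.

Lemma stell_left_KLS_none : inc_val g None None = 1.
Proof. by rewrite inc_valE. Qed.

(** The sum for (g E) splits into one over the sets between the two chains, which
    gives a power of X, and one over [y', y], which gives E f = f^rev. *)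
Lemma rev_stell_left_KLS_some u v : ((Some u : Stell P) <= Some v)%O ->
  inc_val (inc_rev g) (Some u) (Some v) = inc_val (g * ES) (Some u) (Some v).
Proof.
have [grP _] := eulP; have [If _ _ frev] := right_KLSP eulP.
move=> uv; rewrite inc_val_rev stell_left_KLS_some // rho_stell //.
have /andP[cuv yvu] := uv.
rewrite -[inc_val f _ _]mul1r poly_revM ?size_poly1 ?If //.
rewrite poly_rev1 -inc_val_rev frev.
pose Q' (p : {set P} * P) :=
  ((val u).1 \subset p.1) && (p.1 \subset (val v).1) &&
  ((stell_elt v <= p.2)%O && (p.2 <= stell_elt u)%O).
rewrite inc_valM_itv (sum_stell (Q' := Q') (F' := fun p =>
  ('X - 1) ^+ (stell_card v - #|p.1|) *
    (inc_val E (stell_elt v) p.2 * inc_val f p.2 (stell_elt u)))) //; first last.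
- move=> w /andP[uw wv]; rewrite stell_left_KLS_some // eulerian_kernelE // rho_stell //.
  by rewrite eulerian_kernelE ?(stell_some_le_elt wv) // exprD mulrC mulrA.
- move=> w; rewrite !stell_some_le /Q'; case: (_ \subset _) => //=.
  by rewrite andbCA [X in _ && X]andbC.
transitivity (\sum_(p | Q' p) ('X - 1) ^+ (stell_card v - #|p.1|) *
    (inc_val E (stell_elt v) p.2 * inc_val f p.2 (stell_elt u))).
  rewrite inc_valM_itv -sum_between_exp // mulr_suml.
  under eq_bigr => C _ do rewrite mulr_sumr.
  by rewrite pair_big.
apply: eq_bigl => -[C z]; rewrite /stell_pair /Q' /=.
apply/idP/idP => [/[dup] /andP[/andP[uC Cv] /andP[vz _]] ->|/andP[]//]; rewrite andbT.
rewrite (subsetP uC _ (stell_bot_in u)) /=.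
exact: chain_below_le vz (chain_belowS Cv (stell_chain v)).
Qed.

Lemma rev_stell_left_KLS_top u :
  inc_val (inc_rev g) (Some u) None = inc_val g (Some u) None + ('X - 1) * stell_h u.
Proof.
have [grP _] := eulP; rewrite inc_val_rev stell_left_KLS_top rho_stell_top //.
have [sz anti] := antipalindromic_mulX1 (palindromic_stell_h u).
by rewrite [RHS]addrC; apply: (canRL (subrK _)); exact: lower_halfP.
Qed.

Lemma stell_left_KLS_kernel_top u :
  inc_val (g * ES) (Some u) None = inc_val g (Some u) None + ('X - 1) * stell_h u.
Proof.
have [grP _] := eulP; rewrite inc_valM_right ?eulerian_kernel_ss //; congr (_ + _).
rewrite (sum_stell (Q' := fun p => ((val u).1 \subset p.1) && (p.2 <= stell_elt u)%O)
  (F' := fun p => inc_val f p.2 (stell_elt u) * ('X - 1) ^+ ((rank p.2).+1 - #|p.1|).+1)) //.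
  rewrite stell_hE mulr_sumr; apply: eq_bigr => p _.
  by rewrite exprS mulrCA.
- by move=> v; rewrite lt_neqAle /= andbT.
- move=> v; rewrite andbC => /andP[_ uv].
  by rewrite stell_left_KLS_some // eulerian_kernelE // rho_stell_top.
Qed.

Lemma stell_left_KLSP : is_left_KLS g.
Proof.
have [grP _] := eulP; have [If f1 fd frev] := right_KLSP eulP; split.
- move=> [u|] [v|] // uv; last by rewrite stell_left_KLS_none size_poly1.
    rewrite stell_left_KLS_some // rho_stell //.
    apply: leq_trans (If _ _ (stell_some_le_elt uv)) _.
    by rewrite ltnS leq_addl.
  by rewrite stell_left_KLS_top size_lower_half.
- by move=> [u|]; rewrite ?stell_left_KLS_none // stell_left_KLS_some ?f1.
- move=> [u|] [v|] // uv; last first.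
    by rewrite stell_left_KLS_top lower_half_degree // rho_gt0.
  rewrite stell_left_KLS_some ?ltW //; have := stell_some_le_elt (ltW uv).
  rewrite le_eqVlt => /predU1P[->|yvu]; first by rewrite f1 size_poly1 rho_gt0.
  rewrite rho_stell ?ltW //; apply: leq_trans (fd _ _ yvu) _; exact: leq_addl.
apply: incP => -[u|] [v|] // uv; first exact: rev_stell_left_KLS_some.
  by rewrite rev_stell_left_KLS_top stell_left_KLS_kernel_top.
rewrite inc_val_rev rho_ss stell_left_KLS_none poly_rev01 inc_valM_ss.
by rewrite eulerian_kernel_ss stell_left_KLS_none mulr1.
Qed.

Lemma toric_h_stell : toric_h (Stell P) = right_aug_chow P.
Proof.
rewrite /toric_h (left_KLS_eq stell_left_KLSP).
rewrite [X in X - _](rev_stell_left_KLS_top (Sub _ (stell_bot_proof P))) addrC addKr.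
rewrite -polyC1 Pdiv.IdomainMonic.mulKp ?monicXsubC // /stell_h /=.
by rewrite (chain_max_eq chain_below_bot) ?set11 // chain_sum_bot mul1r.
Qed.

End StellKLS.

Theorem theorem1p4 (d : Order.disp_t) (P : finTBPOrderType d) (hP : eulerian P) :
  right_aug_chow P = toric_h (Stell P).
Proof. by rewrite toric_h_stell. Qed.
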